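(* Let $A_1,\ldots,A_m\in\mathbb{M}_d$. Then $$\left|\sum_{k=1}^m A_k\right|\prec_{\mathrm{wlog}}\sum_{k=1}^m|A_k|_{\vee}.$$
   Context: $d,m\ge 1$ are integers, $\mathbb{M}_d$ is the space of complex $d\times d$ matrices and $\mathbb{M}_d^+$ its cone of positive semidefinite matrices. For $A\in\mathbb{M}_d$, $|A|=(A^*A)^{1/2}$, so $|A^*|=(AA^* )^{1/2}$. The maximal modulus of $A$ is the positive semidefinite matrix defined by Kato's formula $$|A|_{\vee}:=\lim_{n\to\infty}\left(|A|^n+|A^*|^n\right)^{1/n}$$ (the limit exists; it is the supremum of $|A|$ and $|A^*|$ in Olson's spectral order). For $A\in\mathbb{M}_d^+$, $\lambda_1^{\downarrow}(A)\ge\cdots\ge\lambda_d^{\downarrow}(A)$ are the eigenvalues of $A$ in nonincreasing order, with multiplicity. For $A,B\in\mathbb{M}_d^+$, the weak log-majorization $A\prec_{\mathrm{wlog}}B$ means $\prod_{j=1}^p\lambda_j^{\downarrow}(A)\le\prod_{j=1}^p\lambda_j^{\downarrow}(B)$ for all $p=1,\ldots,d$. *)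

(* Defs.v *)
From mathcomp Require Import all_boot all_order all_algebra.
From mathcomp Require Import complex.
From mathcomp Require Import all_classical all_reals all_analysis.

Set Implicit Arguments.
Unset Strict Implicit.
Unset Printing Implicit Defensive.

Import Order.TTheory GRing.Theory Num.Theory.
Import numFieldNormedType.Exports.
Local Open Scope classical_set_scope.
Local Open Scope ring_scope.
Local Open Scope sesquilinear_scope.

(* A^(1/n) by functional calculus.  A normal matrix A is P^* D P, where
   P = spectralmx A is unitary and D is the diagonal matrix with diagonal
   spectral_diag A; the root is P^* D^(1/n) P.  For A positive semidefinite and
   n > 0, the entries of D are nonnegative, so n.-root gives their nonnegative
   n-th roots, and the result is the positive semidefinite n-th root of A. *)
Definition mxroot (C : numClosedFieldType) (d n : nat) (A : 'M[C]_d) : 'M[C]_d :=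
  (spectralmx A)^t* *m diag_mx (map_mx (fun x => n.-root x) (spectral_diag A))
    *m spectralmx A.

Definition mxabs (C : numClosedFieldType) (d : nat) (A : 'M[C]_d) : 'M[C]_d :=
  mxroot 2 (A^t* *m A).

(* Kato's formula; the limit is entrywise.  The term n = 0, where the root is
   meaningless, does not affect it. *)
Definition maxmod (R : realType) (d : nat) (A : 'M[R[i]]_d) : 'M[R[i]]_d :=
  lim ((fun n : nat => mxroot n (mxabs A ^+ n + mxabs (A^t*) ^+ n)) @ \oo).

(* The roots of the characteristic polynomial, with multiplicity, in
   nonincreasing order.  Used only for Hermitian matrices, whose eigenvalues are
   real, so that taking real parts only casts them from R[i] to R. *)
Definition eigenvalues (R : realType) (d : nat) (A : 'M[R[i]]_d) : seq R :=
  sort >=%R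
    [seq complex.Re z | z <- sval (closed_field_poly_normal (char_poly A))].

(* Meant for positive semidefinite A and B. *)
Definition wlog_majorized (R : realType) (d : nat) (A B : 'M[R[i]]_d) : Prop :=
  forall p : nat, (1 <= p <= d)%N ->
    \prod_(j < p) (eigenvalues A)`_j <= \prod_(j < p) (eigenvalues B)`_j.

(* Main.v *)
(* Put M_k = |A_k|_v.  The asymptotics of |A|^n + |A^*|^n is governed by
   finitely many eigenvalues: orthonormalizing the eigenvectors of |A| and |A^*|
   by decreasing eigenvalue yields a positive semidefinite M such that
   |A|^n + |A^*|^n and M^n bound each other up to a constant independent of n.
   Comparing eigenbases, this forces Kato's limit to exist and to be M; along
   n = 2^k, monotonicity of the square root gives |A|, |A^*| <= M.

   Since 2 Re <x A, y> <= <x |A^*|, x> + <y |A|, y>, summing over k shows that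
   S = sum M_k dominates T = sum A_k: 2 Re <x T, y> <= <x S, x> + <y S, y>.
   Compressing to the top p left and right singular vectors of T and taking
   determinants, the squared product of the top p singular values of T is at
   most a product of two determinants of p-dimensional compressions of S, each
   at most the product of the top p eigenvalues of S by Courant-Fischer. *)
Require Import Defs.
From mathcomp Require Import all_boot all_order all_algebra.
From mathcomp Require Import perm complex ring.
From mathcomp Require Import all_classical all_reals all_analysis.

Set Implicit Arguments.
Unset Strict Implicit.
Unset Printing Implicit Defensive.

Import Order.TTheory GRing.Theory Num.Theory.
Import numFieldNormedType.Exports.
Local Open Scope ring_scope.
Local Open Scope sesquilinear_scope.

(** * Conjugate transposes *)

Lemma adjmxM (C : numClosedFieldType) m n p (A : 'M[C]_(m, n))
    (B : 'M[C]_(n, p)) :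
  (A *m B)^t* = B^t* *m A^t*.
Proof. by rewrite trmx_mul map_mxM. Qed.

Lemma adjmxD (C : numClosedFieldType) m n (A B : 'M[C]_(m, n)) :
  (A + B)^t* = A^t* + B^t*.
Proof. by rewrite linearD /= map_mxD. Qed.

Lemma adjmxB (C : numClosedFieldType) m n (A B : 'M[C]_(m, n)) :
  (A - B)^t* = A^t* - B^t*.
Proof. by rewrite linearB /= map_mxB. Qed.

Lemma adjmxZ (C : numClosedFieldType) m n a (A : 'M[C]_(m, n)) :
  (a *: A)^t* = a^* *: A^t*.
Proof. by rewrite linearZ /= map_mxZ. Qed.

Lemma adjmx1 (C : numClosedFieldType) n : (1%:M : 'M[C]_n)^t* = 1%:M.
Proof. by rewrite trmx1 map_mx1. Qed.

Lemma adjmx_diag (C : numClosedFieldType) n (l : 'rV[C]_n) :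
  (forall i, l 0 i \is Num.real) -> (diag_mx l)^t* = diag_mx l.
Proof.
move=> lr; rewrite tr_diag_mx map_diag_mx; congr diag_mx.
by apply/rowP => i; rewrite mxE /= conj_Creal.
Qed.

(** * Quadratic forms on row vectors and positive semidefinite matrices *)

Definition qform (C : numClosedFieldType) d (A : 'M[C]_d) (x : 'rV_d) : C :=
  (x *m A *m x^t*) 0 0.

Definition psdmx (C : numClosedFieldType) d (A : 'M[C]_d) : Prop :=
  A^t* = A /\ forall x, 0 <= qform A x.

Lemma qformD (C : numClosedFieldType) d (A B : 'M[C]_d) x :
  qform (A + B) x = qform A x + qform B x.
Proof. by rewrite /qform mulmxDr mulmxDl mxE. Qed.

Lemma qformB (C : numClosedFieldType) d (A B : 'M[C]_d) x :
  qform (A - B) x = qform A x - qform B x.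
Proof. by rewrite /qform mulmxBr mulmxBl !mxE. Qed.

Lemma qform_sum (C : numClosedFieldType) d m (A : 'I_m -> 'M[C]_d) x :
  qform (\sum_k A k) x = \sum_k qform (A k) x.
Proof. by rewrite /qform mulmx_sumr mulmx_suml summxE. Qed.

Lemma qformM (C : numClosedFieldType) p d (A : 'M[C]_d) (X : 'M[C]_(p, d)) x :
  qform (X *m A *m X^t*) x = qform A (x *m X).
Proof. by rewrite /qform adjmxM !mulmxA. Qed.

Lemma qform1E (C : numClosedFieldType) d (x : 'rV[C]_d) :
  qform 1%:M x = \sum_i `|x 0 i| ^+ 2.
Proof.
by rewrite /qform mulmx1 mxE; apply: eq_bigr => i _; rewrite !mxE normCK.
Qed.

Lemma qform1_ge0 (C : numClosedFieldType) d (x : 'rV[C]_d) : 0 <= qform 1%:M x.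
Proof. by rewrite qform1E sumr_ge0 // => i _; rewrite exprn_ge0. Qed.

Lemma qform1_eq0 (C : numClosedFieldType) d (x : 'rV[C]_d) :
  (qform 1%:M x == 0) = (x == 0).
Proof.
rewrite qform1E psumr_eq0 => [|i _]; last by rewrite exprn_ge0.
apply/allP/eqP => [x0|-> i _]; last by rewrite mxE normr0 expr0n /= eqxx.
apply/rowP => i; have := x0 i; rewrite mem_index_enum => /(_ isT).
by rewrite sqrf_eq0 normr_eq0 mxE => /eqP.
Qed.

Lemma qform_diag (C : numClosedFieldType) m d (V : 'M[C]_(m, d)) l x :
  qform (V^t* *m diag_mx l *m V) x =
  \sum_i l 0 i * `|(x *m V^t*) 0 i| ^+ 2.
Proof.
rewrite -[V in _ *m V](@trmxCK C) qformM /qform; set y := x *m _.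
rewrite mul_mx_diag mxE; apply: eq_bigr => i _.
by rewrite !mxE normCK /= mulrAC mulrC.
Qed.

Lemma adjmx_conj_diag (C : numClosedFieldType) m d (V : 'M[C]_(m, d))
    (l : 'rV_m) :
  (forall i, l 0 i \is Num.real) ->
  (V^t* *m diag_mx l *m V)^t* = V^t* *m diag_mx l *m V.
Proof. by move=> lr; rewrite !adjmxM adjmx_diag // trmxCK mulmxA. Qed.

Lemma psdmx_diag (C : numClosedFieldType) m d (V : 'M[C]_(m, d))
    (l : 'rV_m) :
  (forall i, 0 <= l 0 i) -> psdmx (V^t* *m diag_mx l *m V).
Proof.
move=> l0; split=> [|x]; first by apply: adjmx_conj_diag => i; apply/ger0_real.
by rewrite qform_diag sumr_ge0 // => i _; rewrite mulr_ge0 ?exprn_ge0.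
Qed.

Lemma hermitian_spectralE (C : numClosedFieldType) d (A : 'M[C]_d) :
  A^t* = A -> let V := spectralmx A in
  [/\ V *m V^t* = 1%:M, V^t* *m V = 1%:M,
      A = V^t* *m diag_mx (spectral_diag A) *m V &
      forall i, spectral_diag A 0 i \is Num.real].
Proof.
move=> Ah V; have Vu := spectral_unitarymx A.
have hA : A \is hermsymmx by apply/is_hermitianmxP; rewrite expr0 scale1r Ah.
have VV : V *m V^t* = 1%:M by apply/unitarymxP.
split=> //; first exact: mulmx1C.
  have /orthomx_spectralP := hermitian_normalmx hA.
  by rewrite invmx_unitary.
by move=> i; have /mxOverP := hermitian_spectral_diag_real hA; apply.
Qed.

(** The rows of [spectralmx A] are unit eigenvectors; this passes bounds on the form to the
    eigenvalues. *)
Lemma qform_spectral (C : numClosedFieldType) d (A : 'M[C]_d) i :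
  A^t* = A -> qform A (row i (spectralmx A)) = spectral_diag A 0 i.
Proof.
move=> Ah; have [VV _ AE lr] := hermitian_spectralE Ah.
rewrite [in qform _]AE qform_diag -row_mul VV (bigD1 i) //=.
rewrite !mxE eqxx normr1 expr1n mulr1 big1 ?addr0 // => j ji.
by rewrite !mxE eq_sym (negPf ji) normr0 expr0n mulr0.
Qed.

Lemma psdmx_spectral_ge0 (C : numClosedFieldType) d (A : 'M[C]_d) i :
  psdmx A -> 0 <= spectral_diag A 0 i.
Proof. by move=> [Ah A0]; rewrite -qform_spectral. Qed.

Lemma psdmxD (C : numClosedFieldType) d (A B : 'M[C]_d) :
  psdmx A -> psdmx B -> psdmx (A + B).
Proof.
move=> [Ah A0] [Bh B0]; split=> [|x]; first by rewrite adjmxD Ah Bh.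
by rewrite qformD addr_ge0.
Qed.

Lemma psdmx_sum (C : numClosedFieldType) d m (A : 'I_m -> 'M[C]_d) :
  (forall k, psdmx (A k)) -> psdmx (\sum_k A k).
Proof.
move=> Ap; split=> [|x]; last first.
  by rewrite qform_sum sumr_ge0 // => k _; case: (Ap k).
apply: (big_ind (fun B : 'M[C]_d => B^t* = B)) => [|B B' Bh B'h|k _].
- by rewrite trmx0 map_mx0.
- by rewrite adjmxD Bh B'h.
- by case: (Ap k).
Qed.

Lemma psdmx_conj (C : numClosedFieldType) p d (A : 'M[C]_d) (X : 'M[C]_(p, d)) :
  psdmx A -> psdmx (X *m A *m X^t*).
Proof.
move=> [Ah A0]; split=> [|x]; last by rewrite qformM.
by rewrite !adjmxM trmxCK Ah mulmxA.
Qed.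

Lemma psdmx1 (C : numClosedFieldType) d : psdmx (1%:M : 'M[C]_d).
Proof. by split=> [|x]; rewrite ?adjmx1 ?qform1_ge0. Qed.

Lemma psdmx_gram (C : numClosedFieldType) m d (A : 'M[C]_(m, d)) :
  psdmx (A^t* *m A).
Proof.
have := psdmx_conj (A^t*) (psdmx1 C m).
by rewrite mulmx1 trmxCK.
Qed.

(** * Powers, roots and monotonicity of the square root *)

Lemma conj_diagX (C : numClosedFieldType) d (V : 'M[C]_d) l n :
  V *m V^t* = 1%:M ->
  (V^t* *m diag_mx l *m V) ^+ n =
  V^t* *m diag_mx (map_mx (fun z => z ^+ n) l) *m V.
Proof.
move=> VV; have VV' := mulmx1C VV.
elim: n => [|n IHn].
  rewrite expr0; have -> : map_mx (fun z => z ^+ 0) l = const_mx 1.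
    by apply/rowP => i; rewrite !mxE expr0.
  by rewrite diag_const_mx mulmx1 VV'.
rewrite exprS -mulmxE IHn !mulmxA -[_ *m V *m V^t*]mulmxA VV mulmx1.
rewrite -[_ *m diag_mx l *m _]mulmxA mulmx_diag; congr (_ *m diag_mx _ *m _).
by apply/rowP => i; rewrite !mxE exprS.
Qed.

Lemma psdmxX (C : numClosedFieldType) d (A : 'M[C]_d) n :
  psdmx A -> psdmx (A ^+ n).
Proof.
move=> Ap; have [VV _ AE _] := hermitian_spectralE Ap.1.
rewrite AE conj_diagX //; apply: psdmx_diag => i.
by rewrite mxE exprn_ge0 // psdmx_spectral_ge0.
Qed.

Lemma psdmx_mxroot (C : numClosedFieldType) d n (A : 'M[C]_d) :
  (0 < n)%N -> psdmx A -> psdmx (mxroot n A).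
Proof.
move=> n0 Ap; apply: psdmx_diag => i.
by rewrite mxE rootC_ge0 // psdmx_spectral_ge0.
Qed.

Lemma mxrootK (C : numClosedFieldType) d n (A : 'M[C]_d) :
  (0 < n)%N -> psdmx A -> mxroot n A ^+ n = A.
Proof.
move=> n0 Ap; have [VV _ AE _] := hermitian_spectralE Ap.1.
rewrite conj_diagX // [RHS]AE; congr (_ *m diag_mx _ *m _).
by apply/rowP => i; rewrite !mxE rootCK.
Qed.

Lemma psdmx_mxabs (C : numClosedFieldType) d (A : 'M[C]_d) : psdmx (mxabs A).
Proof. by apply: psdmx_mxroot => //; apply: psdmx_gram. Qed.

Lemma mxabs_sqr (C : numClosedFieldType) d (A : 'M[C]_d) :
  mxabs A *m mxabs A = A^t* *m A.
Proof. by rewrite mulmxE -expr2 mxrootK //; apply: psdmx_gram. Qed.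

(* An eigenvector u of Z = Y - X with eigenvalue z satisfies
   u (Y^2 - X^2) u^* = 2 z (u Y u^* ) - z^2 |u|^2, which is negative if z < 0. *)
Lemma psdmx_sqrt_mono (C : numClosedFieldType) d (X Y : 'M[C]_d) :
  X^t* = X -> psdmx Y -> (forall x, qform (X *m X) x <= qform (Y *m Y) x) ->
  forall x, qform X x <= qform Y x.
Proof.
move=> Xh [Yh Y0] le2 x.
have [Z defZ] : exists Z, Z = Y - X by eexists.
have Zh : Z^t* = Z by rewrite defZ adjmxB Xh Yh.
have [VV V'V ZE lr] := hermitian_spectralE Zh.
suff l0 i : 0 <= spectral_diag Z 0 i.
  have [_ /(_ x)] : psdmx Z by rewrite ZE; apply: psdmx_diag.
  by rewrite defZ qformB subr_ge0.
set z := spectral_diag Z 0 i; set u := row i (spectralmx Z).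
have zr : z \is Num.real by apply: lr.
have uZ : u *m Z = z *: u.
  rewrite [in LHS]ZE !mulmxA -row_mul VV row1.
  rewrite -rowE row_diag_mx -scalemxAl -rowE //.
have Zu : Z *m u^t* = z *: u^t*.
  by rewrite -[Z in LHS]Zh -adjmxM uZ adjmxZ conj_Creal.
have uu : u *m u^t* = 1%:M.
  apply/matrixP => a b; rewrite !ord1.
  have /matrixP/(_ i i) := VV; rewrite !mxE !eqxx => <-.
  by apply: eq_bigr => k _; rewrite !mxE.
have E : qform (Y *m Y) u - qform (X *m X) u = z * qform Y u *+ 2 - z ^+ 2.
  have -> : X = Y - Z by rewrite defZ subKr.
  have -> : (Y - Z) *m (Y - Z) = Y *m Y - Y *m Z - Z *m Y + Z *m Z.
    by rewrite mulmxBl !mulmxBr opprB addrA addrAC.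
  rewrite qformD !qformB /qform !mulmxA uZ.
  rewrite -!scalemxAl uZ -[_ *m Z *m _]mulmxA Zu -scalemxAr.
  rewrite -!scalemxAl uu !mxE eqxx /=; ring.
have := le2 u; rewrite -subr_ge0 E.
case/orP: zr => // z0; rewrite subr_ge0 => le.
(* For [z <= 0] the product [z * qform Y u] is nonpositive because [Y] is positive semidefinite, so
   [z] must be 0. *)
have z2 : z ^+ 2 <= 0.
  by apply: le_trans le _; rewrite mulrn_wle0 // mulr_le0_ge0.
have : z ^+ 2 == 0 by rewrite eq_le z2 real_exprn_even_ge0 ?ler0_real.
by rewrite sqrf_eq0 => /eqP->.
Qed.

(** Each square root preserves the order, and [k] of them undo the exponent 2^k; hence Kato's limit
    is later read along powers of two. *)
Lemma psdmx_root2X_mono (C : numClosedFieldType) d (X Y : 'M[C]_d) k :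
  psdmx X -> psdmx Y ->
  (forall x, qform (X ^+ (2 ^ k)) x <= qform (Y ^+ (2 ^ k)) x) ->
  forall x, qform X x <= qform Y x.
Proof.
move=> Xp Yp; elim: k => [|k IHk] // le2; apply: IHk.
apply: psdmx_sqrt_mono => [||x].
- by case: (psdmxX (2 ^ k) Xp).
- exact: psdmxX.
- by rewrite !mulmxE -!expr2 -!exprM mulnC -expnS.
Qed.

(** * Domination of a matrix by a pair of quadratic forms *)

(** For Hermitian [M] and [N] this is positive semidefiniteness of the block matrix
    [M, -A; -A^*, N]; the left side is twice the real part of x A y^*. *)
Definition dominates (C : numClosedFieldType) d (M N A : 'M[C]_d) : Prop :=
  forall x y : 'rV_d, (x *m A *m y^t*) 0 0 + (y *m A^t* *m x^t*) 0 0
    <= qform M x + qform N y.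

Lemma dominates_sum (C : numClosedFieldType) d m (M N A : 'I_m -> 'M[C]_d) :
  (forall k, dominates (M k) (N k) (A k)) ->
  dominates (\sum_k M k) (\sum_k N k) (\sum_k A k).
Proof.
move=> dom x y; rewrite !qform_sum -big_split /=.
have -> : (\sum_k A k)^t* = \sum_k (A k)^t*.
  apply: (big_morph (fun B : 'M[C]_d => B^t*)); first exact: adjmxD.
  by rewrite trmx0 map_mx0.
rewrite !mulmx_sumr !mulmx_suml !summxE -big_split /=.
by apply: ler_sum => k _; apply: dom.
Qed.

Lemma dominates_mono (C : numClosedFieldType) d (M N M' N' A : 'M[C]_d) :
  (forall x, qform M x <= qform M' x) -> (forall x, qform N x <= qform N' x) ->
  dominates M N A -> dominates M' N' A.
Proof.
by move=> leM leN dom x y; apply: le_trans (dom x y) _; rewrite lerD.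
Qed.

Lemma dominates_conj (C : numClosedFieldType) p d (M N A : 'M[C]_d)
    (X Y : 'M[C]_(p, d)) :
  dominates M N A ->
  dominates (X *m M *m X^t*) (Y *m N *m Y^t*) (X *m A *m Y^t*).
Proof.
move=> dom x y; have := dom (x *m X) (y *m Y).
by rewrite !qformM !adjmxM trmxCK !mulmxA.
Qed.

(* With H = [0, A; A^*, 0] and B = diag(|A^*|, |A|) one has H^2 = B^2, so
   H <= B since the square root is operator monotone. *)
Lemma dominates_mxabs (C : numClosedFieldType) d (A : 'M[C]_d) :
  dominates (mxabs (A^t*)) (mxabs A) A.
Proof.
move=> x y; pose H := block_mx 0 A (A^t*) 0.
pose B := block_mx (mxabs (A^t*)) 0 0 (mxabs A).
have [[Mh M0] [Nh N0]] := (psdmx_mxabs (A^t*), psdmx_mxabs A).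
have qB u v : qform B (row_mx u v) = qform (mxabs (A^t*)) u + qform (mxabs A) v.
  rewrite /qform mul_row_block !mulmx0 addr0 add0r tr_row_mx map_col_mx.
  by rewrite mul_row_col mxE.
have := @psdmx_sqrt_mono C _ H B _ _ _ (row_mx x y); rewrite qB.
rewrite /qform mul_row_block !mulmx0 addr0 add0r tr_row_mx map_col_mx.
rewrite mul_row_col mxE addrC; apply.
- by rewrite tr_block_mx map_block_mx trmxCK !trmx0 !map_mx0.
- split=> [|z]; last by rewrite -[z]hsubmxK qB addr_ge0.
  by rewrite tr_block_mx map_block_mx Mh Nh !trmx0 !map_mx0.
move=> z; rewrite /H /B !mulmx_block !(mul0mx, mulmx0, addr0, add0r).
by rewrite !mxabs_sqr trmxCK.
Qed.

Lemma qform1_row (C : numClosedFieldType) m d (V : 'M[C]_(m, d)) i :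
  V *m V^t* = 1%:M -> qform 1%:M (row i V) = 1.
Proof.
move/matrixP/(_ i i); rewrite qform1E !mxE eqxx /= => VV.
by rewrite -[RHS]VV; apply: eq_bigr => k _; rewrite !mxE normCK.
Qed.

Lemma dominates_adj (C : numClosedFieldType) d (M N A : 'M[C]_d) :
  dominates M N A -> dominates N M (A^t*).
Proof. by move=> dom x y; rewrite trmxCK addrC [leRHS]addrC. Qed.

(** * Determinant bound for dominated matrices *)

Lemma det_adjmx (C : numClosedFieldType) d (A : 'M[C]_d) :
  \det (A^t*) = (\det A)^*.
Proof. by rewrite det_map_mx det_tr. Qed.

Lemma det_unitary_conj (C : numClosedFieldType) d (V A : 'M[C]_d) :
  V *m V^t* = 1%:M -> \det (V^t* *m A *m V) = \det A.
Proof.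
move=> VV; rewrite !det_mulmx mulrC mulrA -det_mulmx VV.
by rewrite det1 mul1r.
Qed.

Lemma det_hermitian (C : numClosedFieldType) d (A : 'M[C]_d) :
  A^t* = A -> \det A = \prod_i spectral_diag A 0 i.
Proof.
move=> Ah; have [VV _ AE _] := hermitian_spectralE Ah.
by rewrite [in LHS]AE det_unitary_conj // det_diag.
Qed.

Lemma det_psdmx_ge0 (C : numClosedFieldType) d (A : 'M[C]_d) :
  psdmx A -> 0 <= \det A.
Proof.
move=> Ap; rewrite det_hermitian; last by case: Ap.
by apply: prodr_ge0 => i _; apply: psdmx_spectral_ge0.
Qed.

(** [L] is D^(-1/2) V for a spectral decomposition V^* D V of [A]; such congruences reduce
    domination by two forms to domination by identities. *)
Lemma psdmx_normalize (C : numClosedFieldType) d (A : 'M[C]_d) :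
  psdmx A -> \det A != 0 -> exists L : 'M[C]_d, L *m A *m L^t* = 1%:M.
Proof.
move=> Ap; have [VV V'V AE lr] := hermitian_spectralE Ap.1.
rewrite (det_hermitian Ap.1) => /prodf_neq0 l0.
set V := spectralmx A in VV V'V AE; set l := spectral_diag A in AE lr l0.
pose r := map_mx (fun z => (sqrtC z)^-1) l.
exists (diag_mx r *m V); rewrite [A in LHS]AE adjmxM.
have -> : (diag_mx r)^t* = diag_mx r.
  apply: adjmx_diag => i; rewrite mxE ger0_real // invr_ge0 sqrtC_ge0.
  exact: psdmx_spectral_ge0.
rewrite !mulmxA -[_ *m V *m V^t*]mulmxA VV mulmx1 -[_ *m V *m V^t*]mulmxA VV.
rewrite mulmx1 !mulmx_diag -[RHS]diag_const_mx; congr diag_mx.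
apply/rowP => i; rewrite !mxE mulrAC -invfM -expr2 sqrtCK mulVf //.
exact: l0.
Qed.

(** Testing at y = x K bounds the form of G = K K^* by that of the identity, so the eigenvalues of G
    lie in [0, 1]; their product is |det K|^2. *)
Lemma dominates1_det (C : numClosedFieldType) d (K : 'M[C]_d) :
  dominates 1%:M 1%:M K -> `|\det K| ^+ 2 <= 1.
Proof.
move=> dom; pose G := K *m K^t*.
have Gp : psdmx G by have := psdmx_gram (K^t*); rewrite trmxCK.
have leG x : qform G x <= qform 1%:M x.
  have := dom x (x *m K); rewrite adjmxM.
  have -> : qform 1%:M (x *m K) = qform G x.
    by rewrite -qformM mulmx1.
  by rewrite !mulmxA -/(qform G x) /qform !mulmxA lerD2r.
have -> : `|\det K| ^+ 2 = \det G by rewrite det_mulmx det_adjmx normCK.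
have [VV _ _ _] := hermitian_spectralE Gp.1.
rewrite (det_hermitian Gp.1) prodr_ile1 // => i _.
rewrite psdmx_spectral_ge0 //= -(qform_spectral _ Gp.1).
by apply: le_trans (leG _) _; rewrite qform1_row.
Qed.

(** A null vector x of [P] would give, at (x, t x B), 2 t |x B|^2 <= t^2 (x B) Q (x B)^*, which
    fails for small t > 0 since x B is nonzero. *)
Lemma dominates_det_neq0 (C : numClosedFieldType) d (P Q B : 'M[C]_d) :
  psdmx P -> psdmx Q -> dominates P Q B -> \det B != 0 -> \det P != 0.
Proof.
move=> Pp Qp dom B0; apply/negP; rewrite (det_hermitian Pp.1).
move=> /prodf_eq0[i _].
have [VV _ _ _] := hermitian_spectralE Pp.1.
rewrite -(qform_spectral _ Pp.1); set x := row i _ => /eqP Px.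
have x0 : x != 0.
  apply/negP => /eqP x0; have /(congr1 (row i)) := VV.
  rewrite row_mul -/x x0 mul0mx row1 => /rowP/(_ i).
  by rewrite !mxE !eqxx => /eqP; rewrite eq_sym oner_eq0.
set b := x *m B; have b0 : b != 0.
  apply: contra x0 => /eqP bE.
  rewrite -[x](@mulmxK _ _ _ B) ?unitmxE ?unitfE //.
  by rewrite -/b bE mul0mx.
set beta := qform 1%:M b; set q := qform Q b.
have beta0 : 0 < beta by rewrite lt_neqAle qform1_ge0 eq_sym qform1_eq0 b0.
have q0 : 0 <= q by case: Qp => _; apply.
have q10 : 0 < q + 1 by rewrite ltr_wpDl.
(* This choice makes [t * q <= beta]; the added 1 keeps the denominator positive when [q] is 0. *)
pose t := beta / (q + 1); have t0 : 0 < t by rewrite divr_gt0.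
have := dom x (t *: b); rewrite Px add0r adjmxZ conj_Creal ?gtr0_real //.
have -> : qform Q (t *: b) = t ^+ 2 * q.
  rewrite /qform adjmxZ conj_Creal ?gtr0_real //.
  by rewrite -!scalemxAl -scalemxAr scalerA -expr2 mxE.
have -> : (x *m B *m (t *: b^t*)) 0 0 = t * beta.
  by rewrite -scalemxAr mxE /beta /qform mulmx1.
have -> : (t *: b *m B^t* *m x^t*) 0 0 = t * beta.
  by rewrite -mulmxA -adjmxM -scalemxAl mxE /beta /qform mulmx1.
rewrite -mulrDr expr2 -mulrA ler_pM2l // => le.
have : beta + beta <= beta.
  apply: le_trans le _; rewrite /t mulrAC ler_pdivrMr // ler_pM2l // lerDl.
  exact: ler01.
by rewrite gerDl lt_geF.
Qed.

(** If [B] is invertible, so are [P] and [Q]. Once [L] and [M] normalize these, L B M^* is dominated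
    by identities, and |det L|^2, |det M|^2 are the inverses of det P, det Q. *)
Lemma dominates_det (C : numClosedFieldType) d (P Q B : 'M[C]_d) :
  psdmx P -> psdmx Q -> dominates P Q B ->
  `|\det B| ^+ 2 <= \det P * \det Q.
Proof.
move=> Pp Qp dom; have [->|B0] := eqVneq (\det B) 0.
  by rewrite normr0 expr0n mulr_ge0 // det_psdmx_ge0.
have P0 := dominates_det_neq0 Pp Qp dom B0.
have Q0 : \det Q != 0.
  apply: (dominates_det_neq0 Qp Pp (dominates_adj dom)).
  by rewrite det_adjmx conjC_eq0.
have [L LP] := psdmx_normalize Pp P0; have [M MQ] := psdmx_normalize Qp Q0.
have := dominates_conj L M dom; rewrite LP MQ => /dominates1_det.
have detE (N A : 'M[C]_d) :
    N *m A *m N^t* = 1%:M -> \det A = (`|\det N| ^+ 2)^-1.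
  move/(congr1 (fun Z => \det Z)); rewrite !det_mulmx det_adjmx det1 normCK.
  move=> E; have N0 : \det N != 0.
    by apply: contra_eq_neq E => ->; rewrite !mul0r eq_sym oner_eq0.
  by rewrite invfM -[RHS]mul1r -E; field; rewrite conjC_eq0 N0.
rewrite (detE _ _ LP) (detE _ _ MQ) !det_mulmx det_adjmx !normrM norm_conjC.
have L0 : `|\det L| != 0.
  rewrite normr_eq0; apply: contra_neq P0 => L0.
  by rewrite (detE _ _ LP) L0 normr0 expr0n invr0.
have M0 : `|\det M| != 0.
  rewrite normr_eq0; apply: contra_neq Q0 => M0.
  by rewrite (detE _ _ MQ) M0 normr0 expr0n invr0.
have LM : 0 < `|\det L| ^+ 2 * `|\det M| ^+ 2.
  by rewrite mulr_gt0 // exprn_gt0 // lt_neqAle eq_sym ?L0 ?M0 normr_ge0.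
rewrite -invfM !exprMn -[_^-1]mul1r ler_pdivlMr //.
by rewrite [`|\det B| ^+ 2 * _]mulrCA mulrA.
Qed.

(** * Eigenvalues in nonincreasing order and compressions *)

Lemma char_poly_unitary_diag (C : numClosedFieldType) d (V : 'M[C]_d) l :
  V *m V^t* = 1%:M ->
  char_poly (V^t* *m diag_mx l *m V) = \prod_i ('X - (l 0 i)%:P).
Proof.
move=> VV; have V'V := mulmx1C VV.
have -> : \prod_i ('X - (l 0 i)%:P) = char_poly (diag_mx l).
  rewrite char_poly_trig ?diag_mx_is_trig //.
  by apply: eq_bigr => i _; rewrite mxE eqxx mulr1n.
rewrite /char_poly.
have -> : char_poly_mx (V^t* *m diag_mx l *m V) =
    map_mx polyC (V^t*) *m char_poly_mx (diag_mx l) *m map_mx polyC V.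
  rewrite /char_poly_mx mulmxBr mulmxBl !map_mxM; congr (_ - _).
  rewrite mul_mx_scalar -scalemxAl -map_mxM V'V map_mx1.
  by rewrite scale_scalar_mx mulr1.
rewrite !det_mulmx mulrC mulrA -det_mulmx -map_mxM VV map_mx1.
by rewrite det1 mul1r.
Qed.

(** Both lists are the roots of the characteristic polynomial, and a product of linear factors
    determines its roots with multiplicity. *)
Lemma perm_eigenvalues (R : realType) d (A : 'M[R[i]]_d) :
  A^t* = A -> perm_eq (eigenvalues A)
                [tuple complex.Re (spectral_diag A 0 i) | i < d].
Proof.
move=> Ah; have [VV _ AE _] := hermitian_spectralE Ah.
rewrite /eigenvalues perm_sort.
case: (closed_field_poly_normal (char_poly A)) => s /= sE.
have -> : tval [tuple complex.Re (spectral_diag A 0 i) | i < d] =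
    [seq complex.Re z | z <- [seq spectral_diag A 0 i | i <- enum 'I_d]].
  by rewrite /= -map_comp.
apply: perm_map; apply: prod_XsubC_eq.
have := sE; rewrite (monicP (char_poly_monic A)) scale1r => <-.
rewrite [in LHS]AE char_poly_unitary_diag // big_map.
by rewrite big_enum.
Qed.

Lemma size_eigenvalues (R : realType) d (A : 'M[R[i]]_d) :
  A^t* = A -> size (eigenvalues A) = d.
Proof. by move/perm_eigenvalues/perm_size->; rewrite size_tuple. Qed.

Lemma eigenvalues_nonincreasing (R : realType) d (A : 'M[R[i]]_d) i j :
  A^t* = A -> (i <= j < d)%N -> (eigenvalues A)`_j <= (eigenvalues A)`_i.
Proof.
move=> Ah /andP[ij jd].
have geR_trans : transitive (>=%R : rel R) by move=> y x z xy /le_trans; apply.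
apply: (sorted_leq_nth geR_trans) => //.
- exact: lexx.
- by apply: sort_sorted => x y; rewrite /= orbC le_total.
- by rewrite inE size_eigenvalues // (leq_ltn_trans ij).
- by rewrite inE size_eigenvalues.
Qed.

Definition eigenrow (R : realType) d (A : 'M[R[i]]_d) : 'rV[R[i]]_d :=
  \row_j ((eigenvalues A)`_j)%:C%C.

(** Permuting the rows of [spectralmx A] aligns the eigenvectors with the sorted eigenvalues, so
    that the leading rows belong to the largest ones. *)
Lemma hermitian_eigenvaluesE (R : realType) d (A : 'M[R[i]]_d) :
  A^t* = A -> exists V : 'M[R[i]]_d,
    V *m V^t* = 1%:M /\ A = V^t* *m diag_mx (eigenrow A) *m V.
Proof.
move=> Ah; have [VV _ AE lr] := hermitian_spectralE Ah.
have /tuple_permP[s sE] := perm_eigenvalues Ah.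
have eE j : eigenrow A 0 j = spectral_diag A 0 (s j).
  rewrite mxE sE (nth_map j) ?size_enum_ord // nth_ord_enum tnth_mktuple.
  by rewrite RRe_real.
exists (row_perm s (spectralmx A)); split.
  apply/matrixP => i j; have /matrixP/(_ (s i) (s j)) := VV.
  rewrite !mxE (inj_eq perm_inj) => <-.
  by apply: eq_bigr => k _; rewrite !mxE.
rewrite [LHS]AE; apply/matrixP => i j; rewrite !mul_mx_diag !mxE.
rewrite (reindex_inj (@perm_inj _ s)); apply: eq_bigr => k _.
by rewrite !mxE -eE !mxE.
Qed.

Lemma det_eigenvalues (R : realType) d (A : 'M[R[i]]_d) :
  A^t* = A -> \det A = (\prod_(j < d) (eigenvalues A)`_j)%:C%C.
Proof.
move=> Ah; have [V [VV AE]] := hermitian_eigenvaluesE Ah.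
rewrite [in LHS]AE det_unitary_conj // det_diag rmorph_prod.
by apply: eq_bigr => i _; rewrite mxE.
Qed.

Lemma qform_eigenvalue (R : realType) d (A V : 'M[R[i]]_d) i :
  V *m V^t* = 1%:M -> A = V^t* *m diag_mx (eigenrow A) *m V ->
  qform A (row i V) = ((eigenvalues A)`_i)%:C%C.
Proof.
move=> VV AE; rewrite [in qform _]AE qform_diag -row_mul VV (bigD1 i) //=.
rewrite !mxE eqxx normr1 expr1n mulr1 big1 ?addr0 // => j ji.
by rewrite !mxE eq_sym (negPf ji) normr0 expr0n mulr0.
Qed.

Lemma eigenvalues_ge0 (R : realType) d (A : 'M[R[i]]_d) i :
  psdmx A -> 0 <= (eigenvalues A)`_i.
Proof.
move=> [Ah A0]; have [V [VV AE]] := hermitian_eigenvaluesE Ah.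
(* For [i >= d] the entry is the default value 0. *)
have [id|di] := ltnP i d; last by rewrite nth_default // size_eigenvalues.
rewrite -lecR -(qform_eigenvalue (Ordinal id) VV AE); exact: A0.
Qed.

Lemma prod_eigenvalues_ge0 (R : realType) d (A : 'M[R[i]]_d) p :
  psdmx A -> 0 <= \prod_(j < p) (eigenvalues A)`_j.
Proof. by move=> Ap; apply: prodr_ge0 => j _; apply: eigenvalues_ge0. Qed.

(* Courant-Fischer: some nonzero vector in the span of the first j + 1
   eigenvectors of Y S Y^* is mapped by Y into the orthogonal complement of the
   first j eigenvectors of S. *)
Lemma eigenvalues_compression (R : realType) p d (S : 'M[R[i]]_d)
    (Y : 'M[R[i]]_(p, d)) j :
  (p <= d)%N -> S^t* = S -> Y *m Y^t* = 1%:M -> (j < p)%N ->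
  (eigenvalues (Y *m S *m Y^t*))`_j <= (eigenvalues S)`_j.
Proof.
move=> pd Sh YY jp; set H := _ *m _ *m _.
have Hh : H^t* = H by rewrite /H !adjmxM trmxCK Sh mulmxA.
have [V [VV HE]] := hermitian_eigenvaluesE Hh.
have [U [UU SE]] := hermitian_eigenvaluesE Sh.
have jd : (j < d)%N := leq_trans jp pd.
pose W := rowsub (widen_ord jp) V.
pose U1 := rowsub (widen_ord (ltnW jd)) U.
(* The matrix has [j.+1] rows and [j] columns, so its left kernel is nonzero. *)
have [a a0 aK] : exists2 a : 'rV_j.+1, a != 0 & a *m (W *m Y *m U1^t*) = 0.
  have : kermx (W *m Y *m U1^t*) != 0.
    rewrite -mxrank_eq0 mxrank_ker -lt0n subn_gt0 ltnS.
    exact: rank_leq_col.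
  by move=> /rowV0Pn[a /sub_kermxP aK a0]; exists a.
have WW : W *m W^t* = 1%:M.
  apply/matrixP => r s.
  have /matrixP/(_ (widen_ord jp r) (widen_ord jp s)) := VV.
  rewrite !mxE -val_eqE /= => <-.
  by apply: eq_bigr => k _; rewrite !mxE.
have nrmW q (b : 'rV[R[i]]_q) n (Z : 'M[R[i]]_(q, n)) :
    Z *m Z^t* = 1%:M -> qform 1%:M (b *m Z) = qform 1%:M b.
  by move=> ZZ; rewrite -qformM mulmx1 ZZ.
have nrm0 : 0 < qform 1%:M a.
  by rewrite lt_neqAle qform1_ge0 eq_sym qform1_eq0 a0.
have V'V := mulmx1C VV; have U'U := mulmx1C UU.
rewrite -lecR -(ler_pM2r nrm0).
(* The form at [a *m W] separates the two bounds: in the eigenbasis of [H] the coordinates of this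
   vector vanish beyond index [j]. *)
apply: (@le_trans _ _ (qform H (a *m W))).
  rewrite [in qform H _]HE qform_diag -[X in _ * X](nrmW _ _ _ _ WW).
  rewrite -[X in _ * X](nrmW _ _ _ (V^t*)) ?trmxCK // qform1E mulr_sumr.
  apply: ler_sum => i _; have [ij|ji] := leqP i j.
    rewrite ler_wpM2r ?exprn_ge0 // mxE lecR eigenvalues_nonincreasing //.
    by rewrite ij jp.
  suff -> : (a *m W *m V^t*) 0 i = 0 by rewrite normr0 expr0n !mulr0.
  rewrite -mulmxA mxE big1 // => k _; rewrite mul_rowsub_mx VV !mxE.
  rewrite -val_eqE /= ltn_eqF ?mulr0 //.
  by apply: leq_trans ji; apply: ltn_ord.
rewrite /H qformM.
(* By the choice of [a], the coordinates of [a *m W *m Y] in the eigenbasis of [S] vanish before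
   index [j]. *)
rewrite [in qform S _]SE qform_diag -(nrmW _ _ _ _ WW) -(nrmW _ _ _ _ YY).
rewrite -[X in _ * X](nrmW _ _ _ (U^t*)) ?trmxCK // qform1E mulr_sumr.
apply: ler_sum => i _; have [ij|ji] := ltnP i j; last first.
  rewrite ler_wpM2r ?exprn_ge0 // mxE lecR eigenvalues_nonincreasing //.
  by rewrite ji /=.
suff -> : (a *m W *m Y *m U^t*) 0 i = 0 by rewrite normr0 expr0n !mulr0.
have /rowP/(_ (Ordinal ij)) := aK; rewrite !mulmxA !mxE => aK0.
rewrite -[RHS]aK0; apply: eq_bigr => k _; congr (_ * _); rewrite !mxE.
by congr ((U _ _)^*); apply: val_inj.
Qed.

(** * From domination to weak log-majorization *)

Lemma le_of_sqr_leM (F : realDomainType) (a b c e : F) :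
  0 <= b -> 0 <= c -> b <= e -> c <= e -> a ^+ 2 <= b * c -> a <= e.
Proof.
move=> b0 c0 be ce le; rewrite leNgt; apply/negP => ea.
have e0 := le_trans b0 be.
have := le_trans le (ler_pM b0 c0 be ce).
by rewrite -expr2 leNgt ltrXn2r.
Qed.

Lemma prod_compression_le (R : realType) p d (S : 'M[R[i]]_d)
    (Y : 'M[R[i]]_(p, d)) :
  (p <= d)%N -> psdmx S -> Y *m Y^t* = 1%:M ->
  \prod_(j < p) (eigenvalues (Y *m S *m Y^t*))`_j
    <= \prod_(j < p) (eigenvalues S)`_j.
Proof.
move=> pd Sp YY; have YSp := psdmx_conj Y Sp.
apply: ler_prod => j _; apply/andP; split; first exact: eigenvalues_ge0.
exact: eigenvalues_compression pd Sp.1 YY (ltn_ord j).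
Qed.

(* Compressing the domination to the top p left and right singular vectors
   of T turns T into the diagonal matrix of its top p singular values. *)
Lemma dominates_wlog (R : realType) d (S T : 'M[R[i]]_d) :
  psdmx S -> dominates S S T -> wlog_majorized (mxabs T) S.
Proof.
move=> Sp dom; move: (psdmx_mxabs T) (mxabs_sqr T).
move: (mxabs T) => N Np NN p /andP[_ pd].
have [V [VV NE]] := hermitian_eigenvaluesE Np.1.
(* A vanishing singular value among the first [p] makes the left product 0; otherwise these values
   can be inverted. *)
have [/existsP[i s0]|] := boolP [exists i : 'I_p, (eigenvalues N)`_i == 0].
  apply: (@le_trans _ _ 0); last exact: prod_eigenvalues_ge0.
  by rewrite le_eqVlt; apply/orP; left; apply/prodf_eq0; exists i.
rewrite negb_exists => /forallP s0.
pose f := widen_ord pd; pose W := rowsub f V.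
pose s := \row_(i < p) ((eigenvalues N)`_i)%:C%C.
have sr i : s 0 i \is Num.real by rewrite mxE; apply/complex_realP; eexists.
have s_neq0 i : s 0 i != 0 by rewrite mxE (inj_eq (@complexI R)) s0.
have VTV : V *m (T^t* *m T) *m V^t* =
    diag_mx (map_mx (fun z => z ^+ 2) (eigenrow N)).
  have -> : T^t* *m T = N ^+ 2 by rewrite expr2 -mulmxE NN.
  rewrite [in LHS]NE conj_diagX //.
  by rewrite !mulmxA VV mul1mx -mulmxA VV mulmx1.
have WTW : W *m (T^t* *m T) *m W^t* = diag_mx (map_mx (fun z => z ^+ 2) s).
  apply/matrixP => i j; have /matrixP/(_ (f i) (f j)) := VTV.
  rewrite /W mul_rowsub_mx !mxE -!val_eqE /= => <-.
  by apply: eq_bigr => k _; rewrite !mxE.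
pose D := diag_mx (map_mx (fun z => z^-1) s).
have Dh : D^t* = D by apply: adjmx_diag => i; rewrite mxE realV.
have DW : D *m (W *m (T^t* *m T) *m W^t*) = diag_mx s.
  rewrite WTW mulmx_diag; congr diag_mx; apply/rowP => i.
  by rewrite !mxE expr2 mulKf //; have := s_neq0 i; rewrite mxE.
(* The rows of [W] are right singular vectors of [T]; those of [X] are the matching left ones. *)
pose X := D *m W *m T^t*.
have XX : X *m X^t* = 1%:M.
  rewrite /X !adjmxM trmxCK Dh !mulmxA in DW *; rewrite DW mulmx_diag.
  rewrite -[RHS]diag_const_mx; congr diag_mx; apply/rowP => i.
  by rewrite !mxE mulfV //; have := s_neq0 i; rewrite mxE.
have WW : W *m W^t* = 1%:M.
  apply/matrixP => i j; have /matrixP/(_ (f i) (f j)) := VV.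
  rewrite !mxE -val_eqE /= => <-.
  by apply: eq_bigr => k _; rewrite !mxE.
have := dominates_conj X W dom.
have -> : X *m T *m W^t* = diag_mx s by rewrite -DW /X !mulmxA.
move/(dominates_det (psdmx_conj X Sp) (psdmx_conj W Sp)).
have [XSp WSp] := (psdmx_conj X Sp, psdmx_conj W Sp).
rewrite det_diag (det_eigenvalues XSp.1) (det_eigenvalues WSp.1).
have -> : \prod_i s 0 i = (\prod_(i < p) (eigenvalues N)`_i)%:C%C.
  by rewrite rmorph_prod; apply: eq_bigr => i _; rewrite mxE.
rewrite -rmorphM /= ger0_norm; last first.
  by rewrite ler0c; apply: prod_eigenvalues_ge0.
rewrite -rmorphXn lecR => le.
exact: (le_of_sqr_leM (prod_eigenvalues_ge0 p XSp)
  (prod_eigenvalues_ge0 p WSp) (prod_compression_le pd Sp XX)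
  (prod_compression_le pd Sp WW) le).
Qed.

(** * Comparing the bases of n-th powers *)

(** The tangent of t^(m+1) at [a] lies below the curve. *)
Lemma bernoulli_gap (F : numDomainType) (a b : F) m :
  0 <= a -> a <= b -> a ^+ m.+1 + m.+1%:R * a ^+ m * (b - a) <= b ^+ m.+1.
Proof.
move=> a0 ab; have d0 : 0 <= b - a by rewrite subr_ge0.
have b0 := le_trans a0 ab.
elim: m => [|m IHm]; first by rewrite expr0 mulr1 mul1r !expr1 subrKC.
rewrite [leRHS]exprS; apply: le_trans (ler_wpM2l b0 IHm).
rewrite -subr_ge0; set D := b - a.
have -> : b = a + D by rewrite /D subrKC.
have -> : (a + D) * (a ^+ m.+1 + m.+1%:R * a ^+ m * D) -
    (a ^+ m.+2 + m.+2%:R * a ^+ m.+1 * D) = m.+1%:R * a ^+ m * D ^+ 2.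
  rewrite !exprS -[m.+2]addn1 -[m.+1]addn1 !natrD; ring.
by rewrite !mulr_ge0 ?ler0n ?exprn_ge0.
Qed.

(** The tangent bound for the exponent [n./2] is squared, to match the square of [x], and a^(n-2) is
    cancelled; this is why the rate is in [n./2]. *)
Lemma ge0_expr_gap (F : numFieldType) (x a b K : F) n :
  (0 < n)%N -> 0 <= x -> 0 <= K -> 0 <= a -> a <= b ->
  x ^+ 2 * b ^+ n <= K * a ^+ n ->
  (x * (b - a) * n./2%:R) ^+ 2 <= K * a ^+ 2.
Proof.
move=> n0 x0 K0 a0 ab le; have b0 := le_trans a0 ab.
have [m0|] := posnP n./2; first by rewrite m0 mulr0 expr0n mulr_ge0 ?exprn_ge0.
case mE : n./2 => [|m] // _.
have nE : n = (odd n + m.*2.+2)%N by rewrite -[LHS]odd_double_half mE.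
(* For [a = 0] the hypothesis forces [x] or [b] to vanish. *)
have [aE|a_neq0] := eqVneq a 0.
  move: le; rewrite aE subr0 expr0n -[(_ == 0)%N]negbK -lt0n n0 /= mulr0 => le.
  have : x ^+ 2 * b ^+ n == 0 by rewrite eq_le le mulr_ge0 ?exprn_ge0.
  rewrite mulf_eq0 !expf_eq0 n0 /= => /orP[]/eqP->.
    by rewrite !mul0r expr0n /= mulr0.
  by rewrite !(mul0r, mulr0) expr0n /= mulr0.
have a_gt0 : 0 < a by rewrite lt_neqAle eq_sym a_neq0.
rewrite -(ler_pM2l (exprn_gt0 (odd n + m.*2) a_gt0)).
have -> : a ^+ (odd n + m.*2) * (K * a ^+ 2) = K * a ^+ n.
  by rewrite mulrCA -exprD [in RHS]nE addn2 !addnS.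
apply: le_trans le; rewrite [X in b ^+ X]nE.
have -> : a ^+ (odd n + m.*2) * (x * (b - a) * m.+1%:R) ^+ 2 =
    x ^+ 2 * (a ^+ odd n * (m.+1%:R * a ^+ m * (b - a)) ^+ 2).
  by rewrite exprD -mul2n mulnC exprM; ring.
rewrite ler_wpM2l ?exprn_ge0 // exprD -doubleS -muln2 exprM.
have h : m.+1%:R * a ^+ m * (b - a) <= b ^+ m.+1.
  by apply: le_trans (bernoulli_gap m a0 ab); rewrite lerDr exprn_ge0.
have h0 : 0 <= m.+1%:R * a ^+ m * (b - a).
  by rewrite !mulr_ge0 ?exprn_ge0 // subr_ge0.
by apply: ler_pM; rewrite ?exprn_ge0 ?lerXn2r ?nnegrE ?exprn_ge0.
Qed.

(* If two n-th powers agree up to the factor K / x^2, then their bases differ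
   by O(1 / n); the factor x is kept on the left since it may vanish. *)
Lemma expr_gap (F : numFieldType) (x r a K : F) n :
  (0 < n)%N -> 0 <= x -> 1 <= K -> 0 <= a -> 0 <= r ->
  x ^+ 2 * r ^+ n <= K * a ^+ n -> x ^+ 2 * a ^+ n <= K * r ^+ n ->
  x * `|r - a| * n./2%:R <= K * a.
Proof.
move=> n0 x0 K1 a0 r0 le1 le2; have K0 : 0 <= K by rewrite (le_trans ler01).
rewrite -(@ler_pXn2r _ 2) ?nnegrE ?mulr_ge0 //.
have le3 : K * a ^+ 2 <= (K * a) ^+ 2.
  by rewrite exprMn ler_wpM2r ?exprn_ge0 // expr2 ler_peMl.
have [ar|ra] := real_leP (ger0_real a0) (ger0_real r0).
  exact: le_trans (ge0_expr_gap n0 x0 K0 a0 ar le1) le3.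
apply: le_trans (ge0_expr_gap n0 x0 K0 r0 (ltW ra) le2) _.
by apply: le_trans le3; rewrite ler_wpM2l // lerXn2r ?nnegrE // ltW.
Qed.

Lemma normD_sqr_le (F : numDomainType) (u v : F) :
  `|u + v| ^+ 2 <= 2 * (`|u| ^+ 2 + `|v| ^+ 2).
Proof.
apply: (@le_trans _ _ ((`|u| + `|v|) ^+ 2)).
  by rewrite lerXn2r ?nnegrE ?addr_ge0 ?ler_normD.
rewrite -subr_ge0.
have -> : 2 * (`|u| ^+ 2 + `|v| ^+ 2) - (`|u| + `|v|) ^+ 2 = (`|u| - `|v|) ^+ 2.
  ring.
by rewrite real_exprn_even_ge0 // rpredB ?normr_real.
Qed.

Lemma ler_wsum2 (F : numDomainType) (K c1 c2 u v : F) :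
  0 <= u -> 0 <= v -> c1 <= K -> c2 <= K -> c1 * u + c2 * v <= K * (u + v).
Proof. by move=> *; rewrite mulrDr lerD ?ler_wpM2r. Qed.

(** * Orthonormalizing weighted sums of squares *)

Lemma qform_cauchy (C : numClosedFieldType) d (u v : 'rV[C]_d) :
  `|(u *m v^t*) 0 0| ^+ 2 <= qform 1%:M u * qform 1%:M v.
Proof.
rewrite /qform !mulmx1 -!dotmxE.
by have [] := CauchySchwarz (@dotmx C d) u v.
Qed.

(** Only the weights depend on [n], which allows comparisons uniform in [n]; at n = 0 every weight
    is 1, even that of a zero eigenvalue. *)
Definition seq_wform (R : realType) d (s : seq (R * 'rV[R[i]]_d)) n
    (x : 'rV_d) : R[i] :=
  \sum_(p <- s) (p.1 ^+ n)%:C%C * `|(x *m p.2^t*) 0 0| ^+ 2.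

Definition mx_wform (R : realType) m d (E : 'M[R[i]]_(m, d)) (mu : 'rV[R]_m)
    n (x : 'rV_d) : R[i] :=
  \sum_i (mu 0 i ^+ n)%:C%C * `|(x *m E^t*) 0 i| ^+ 2.

Lemma seq_wform_ge0 (R : realType) d (s : seq (R * 'rV[R[i]]_d)) n x :
  all (fun p => 0 <= p.1) s -> 0 <= seq_wform s n x.
Proof.
move=> s0; rewrite /seq_wform big_seq sumr_ge0 // => p ps.
by rewrite mulr_ge0 ?exprn_ge0 // ler0c exprn_ge0 // (allP s0).
Qed.

Lemma mx_wform_ge0 (R : realType) m d (E : 'M[R[i]]_(m, d)) (mu : 'rV[R]_m)
    n x :
  (forall i, 0 <= mu 0 i) -> 0 <= mx_wform E mu n x.
Proof.
move=> mu0; rewrite sumr_ge0 // => i _.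
by rewrite mulr_ge0 ?exprn_ge0 // ler0c exprn_ge0.
Qed.

Lemma seq_wform_cons (R : realType) d p (s : seq (R * 'rV[R[i]]_d)) n x :
  seq_wform (p :: s) n x =
  (p.1 ^+ n)%:C%C * `|(x *m p.2^t*) 0 0| ^+ 2 + seq_wform s n x.
Proof. by rewrite /seq_wform big_cons. Qed.

Lemma mx_wform_col (R : realType) m d (e : 'rV[R[i]]_d) (E : 'M[R[i]]_(m, d))
    (a : R) (mu : 'rV[R]_m) n x :
  mx_wform (col_mx e E) (row_mx a%:M mu) n x =
  (a ^+ n)%:C%C * `|(x *m e^t*) 0 0| ^+ 2 + mx_wform E mu n x.
Proof.
rewrite /mx_wform big_split_ord big_ord1 /= tr_col_mx map_row_mx mul_mx_row.
rewrite !row_mxEl !mxE eqxx mulr1n; congr (_ + _).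
by apply: eq_bigr => i _; rewrite !row_mxEr.
Qed.

(* The vectors are orthonormalized by decreasing weight, so that both each
   vector and each basis element are combinations of their counterparts of
   larger or equal weight; hence the constant K does not depend on n. *)
Lemma gram_schmidt_wform (R : realType) d (s : seq (R * 'rV[R[i]]_d)) :
  sorted (fun p q => p.1 <= q.1) s -> all (fun p => 0 <= p.1) s ->
  exists m (E : 'M[R[i]]_(m, d)) (mu : 'rV[R]_m) (K : R[i]),
  [/\ E *m E^t* = 1%:M,
      forall c, all (fun p => c <= p.1) s -> forall i, c <= mu 0 i,
      0 <= K &
      forall n x, seq_wform s n x <= K * mx_wform E mu n x /\
                  mx_wform E mu n x <= K * seq_wform s n x].
Proof.
elim: s => [_ _|[a w] s IHs].
  exists 0%N, 0, 0, 0; split=> // [|c _ []//|n x].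
    by apply/matrixP => -[].
  by rewrite /seq_wform /mx_wform big_nil big_ord0 mulr0.
rewrite [sorted _ _]/= path_sortedE; last by move=> p q r; apply: le_trans.
move=> /andP[as_ ss] /= /andP[a0 s0].
have [m [E [mu [K [EE mu_ge K0 bd]]]]] := IHs ss s0.
(* The head of the sorted list has the least weight, so the basis built from the tail only carries
   weights at least [a]. *)
have amu i : a <= mu 0 i by apply: mu_ge.
have mu0 i : 0 <= mu 0 i by apply: mu_ge.
set v := w *m E^t*; pose w' := w - v *m E.
have w'E : w' *m E^t* = 0 by rewrite mulmxBl -mulmxA EE mulmx1 subrr.
set L := qform 1%:M v; have L0 : 0 <= L := qform1_ge0 _.
set h := qform 1%:M w'; have h0 : 0 <= h := qform1_ge0 _.
pose an n : R[i] := (a ^+ n)%:C%C.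
have an0 n : 0 <= an n by rewrite ler0c exprn_ge0.
pose ga (x : 'rV[R[i]]_d) := (x *m w'^t*) 0 0.
pose de (x : 'rV[R[i]]_d) := (x *m E^t* *m v^t*) 0 0.
have al x : (x *m w^t*) 0 0 = ga x + de x.
  have {1}-> : w = w' + v *m E by rewrite subrK.
  by rewrite adjmxD adjmxM mulmxDr mulmxA mxE.
(* After Cauchy-Schwarz, a <= mu_i absorbs a^n into mu_i^n, so the factor [L] does not involve
   [n]. *)
have deB n x : an n * `|de x| ^+ 2 <= L * mx_wform E mu n x.
  apply: (@le_trans _ _ (an n * (qform 1%:M (x *m E^t*) * L))).
    by rewrite ler_wpM2l // qform_cauchy.
  rewrite mulrA [leLHS]mulrC ler_wpM2l // qform1E mulr_sumr.
  apply: ler_sum => i _; rewrite ler_wpM2r ?exprn_ge0 // lecR.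
  by rewrite lerXn2r ?nnegrE.
have Bge0 n x : 0 <= mx_wform E mu n x by apply: mx_wform_ge0.
have Age0 n x : 0 <= seq_wform s n x by apply: seq_wform_ge0.
(* If [h] is 0, then [w] lies in the row span of [E] and no row is added. *)
have [hE|h_neq0] := eqVneq h 0.
  have w'0 : w' = 0 by apply/eqP; rewrite -qform1_eq0 -/h hE.
  exists m, E, mu, (K + L); split=> // [c /andP[_ cs] i||n x].
  - exact: mu_ge.
  - exact: addr_ge0.
  have [le1 le2] := bd n x; rewrite seq_wform_cons /= al.
  have -> : ga x = 0 by rewrite /ga w'0 trmx0 map_mx0 mulmx0 mxE.
  rewrite add0r -/(an n); split.
    by rewrite addrC mulrDl lerD.
  apply: le_trans le2 _; apply: ler_pM => //; first by rewrite lerDl.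
  by rewrite lerDr mulr_ge0 ?exprn_ge0.
have h_gt0 : 0 < h by rewrite lt_neqAle eq_sym h_neq0.
pose c := (sqrtC h)^-1; have c0 : 0 <= c by rewrite invr_ge0 sqrtC_ge0.
have cr : c^* = c by rewrite conj_Creal ?ger0_real.
have c2 : c ^+ 2 = h^-1 by rewrite exprVn sqrtCK.
pose e := c *: w'.
have eX x : `|(x *m e^t*) 0 0| ^+ 2 = `|ga x| ^+ 2 / h.
  rewrite /e adjmxZ cr -scalemxAr mxE normrM exprMn -/(ga x) mulrC.
  by rewrite (ger0_norm c0) c2.
have ee : e *m e^t* = 1%:M.
  apply/matrixP => i j; rewrite !ord1 [RHS]mxE eqxx.
  rewrite /e adjmxZ cr -scalemxAl -scalemxAr scalerA -expr2 c2 mxE.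
  have -> : (w' *m w'^t*) 0 0 = h by rewrite /h /qform mulmx1.
  exact: mulVf.
have eE : e *m E^t* = 0 by rewrite -scalemxAl w'E scaler0.
have Ee : E *m e^t* = 0.
  by rewrite -[E](@trmxCK R[i]) -adjmxM eE trmx0 map_mx0.
(* Both constants come from |u + v|^2 <= 2 (|u|^2 + |v|^2), applied to x w^* = ga + de for [K1] and
   to ga = x w^* - de for [K2]; [h] enters through normalizing [w']. *)
pose K1 := 2 * h + (2 * L + K); pose K2 := 2 / h + (2 / h * L + 1) * K.
have hh : 0 <= 2 * h by rewrite mulr_ge0.
have LK : 0 <= 2 * L + K by rewrite addr_ge0 // mulr_ge0.
have K10 : 0 <= K1 by rewrite addr_ge0.
have h20 : 0 <= 2 / h :> R[i] by rewrite divr_ge0.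
have K3 : 0 <= (2 / h * L + 1) * K by rewrite mulr_ge0 // addr_ge0 // mulr_ge0.
have K20 : 0 <= K2 by rewrite addr_ge0.
exists (1 + m)%N, (col_mx e E), (row_mx a%:M mu), (K1 + K2).
split=> [|b /andP[ba bs] i||n x].
- rewrite tr_col_mx map_row_mx mul_col_row ee eE Ee EE.
  by rewrite -scalar_mx_block.
- have := splitP i; case=> j ij.
    have -> : i = lshift m j by apply: val_inj.
    by rewrite row_mxEl !ord1 mxE eqxx.
  have -> : i = rshift 1 j by apply: val_inj.
  by rewrite row_mxEr; apply: mu_ge.
- exact: addr_ge0.
have [le1 le2] := bd n x; rewrite seq_wform_cons mx_wform_col /= al eX.
rewrite -/(an n); set A := seq_wform s n x in le1 le2 *.
set B := mx_wform E mu n x in le1 le2 *.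
have gah : `|ga x| ^+ 2 = h * (`|ga x| ^+ 2 / h) by rewrite mulrC divfK.
have dB := deB n x; rewrite -/B in dB.
have ga0 : 0 <= an n * (`|ga x| ^+ 2 / h).
  by rewrite mulr_ge0 // divr_ge0 ?exprn_ge0.
have al0 : 0 <= an n * `|ga x + de x| ^+ 2 by rewrite mulr_ge0 ?exprn_ge0.
have [B0 A0] : 0 <= B /\ 0 <= A by split; [apply: Bge0 | apply: Age0].
split.
  apply: (@le_trans _ _
      (2 * h * (an n * (`|ga x| ^+ 2 / h)) + (2 * L + K) * B)).
    rewrite [(2 * L + K) * B]mulrDl addrA lerD //.
    apply: le_trans (ler_wpM2l (an0 n) (normD_sqr_le _ _)) _.
    rewrite {1}gah -subr_ge0.
    set t := _ / h in gah *.
    have -> : 2 * h * (an n * t) + 2 * L * B -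
       an n * (2 * (h * t + `|de x| ^+ 2))
       = 2 * (L * B - an n * `|de x| ^+ 2) by ring.
    by rewrite mulr_ge0 // subr_ge0.
  apply: ler_wsum2 => //.
    by rewrite /K1 -addrA lerDl addr_ge0.
  by rewrite /K1 [2 * h + _]addrC -addrA lerDl addr_ge0.
apply: (@le_trans _ _
    (2 / h * (an n * `|ga x + de x| ^+ 2) + (2 / h * L + 1) * K * A)).
  apply: (@le_trans _ _
    (2 / h * (an n * `|ga x + de x| ^+ 2) + (2 / h * L + 1) * B)).
    rewrite [(_ + 1) * B]mulrDl mul1r addrA lerD2r.
    have gE : ga x = (ga x + de x) - de x by rewrite addrK.
    rewrite [in leLHS]gE.
    apply: le_trans (ler_wpM2l (an0 n) (ler_wpM2r _ (normD_sqr_le _ _))) _.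
      by rewrite invr_ge0.
    rewrite normrN -subr_ge0.
    set t := `|ga x + de x| ^+ 2.
    have -> : 2 / h * (an n * t) + 2 / h * L * B -
       an n * (2 * (t + `|de x| ^+ 2) / h)
       = 2 / h * (L * B - an n * `|de x| ^+ 2) by ring.
    by rewrite mulr_ge0 // subr_ge0.
  by rewrite lerD2l -[_ * K * A]mulrA ler_wpM2l // addr_ge0 // mulr_ge0.
apply: ler_wsum2 => //.
  by rewrite /K2 addrCA lerDl addr_ge0.
by rewrite /K2 addrA lerDr addr_ge0.
Qed.

Lemma qform_expE (R : realType) d (X : 'M[R[i]]_d) n x :
  psdmx X -> qform (X ^+ n) x =
  seq_wform [seq (complex.Re (spectral_diag X 0 i), row i (spectralmx X))
            | i <- enum 'I_d] n x.
Proof.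
move=> Xp; have [VV _ XE lr] := hermitian_spectralE Xp.1.
rewrite [in LHS]XE conj_diagX // qform_diag /seq_wform big_map big_enum /=.
apply: eq_bigr => i _; rewrite mxE rmorphXn /= RRe_real //.
congr (_ * `|_| ^+ 2).
by rewrite !mxE; apply: eq_bigr => k _; rewrite !mxE.
Qed.

(** The eigenpairs of [X] and [Y], joined and sorted by eigenvalue, give one list serving all
    [n]. *)
Lemma qform_expD_seq (R : realType) d (X Y : 'M[R[i]]_d) :
  psdmx X -> psdmx Y -> exists s : seq (R * 'rV[R[i]]_d),
  [/\ sorted (fun p q => p.1 <= q.1) s, all (fun p => 0 <= p.1) s &
      forall n x, qform (X ^+ n + Y ^+ n) x = seq_wform s n x].
Proof.
move=> Xp Yp.
pose sp (Z : 'M[R[i]]_d) :=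
  [seq (complex.Re (spectral_diag Z 0 i), row i (spectralmx Z))
  | i <- enum 'I_d].
exists (sort (fun p q => p.1 <= q.1) (sp X ++ sp Y)); split=> [||n x].
- by apply: sort_sorted => p q; apply: le_total.
- have sp0 Z : psdmx Z -> all (fun p => 0 <= p.1) (sp Z).
    move=> Zp; apply/allP => _ /mapP[i _ ->] /=; rewrite -ler0c.
    have := psdmx_spectral_ge0 i Zp; rewrite lecE /= => /andP[/eqP im re].
    by rewrite ler0c.
  by rewrite all_sort all_cat !sp0.
rewrite qformD !qform_expE // -/(sp X) -/(sp Y) /seq_wform.
by rewrite -big_cat; apply/perm_big; rewrite perm_sym perm_sort.
Qed.

Lemma qform_expD_asymp (R : realType) d (X Y : 'M[R[i]]_d) :
  psdmx X -> psdmx Y ->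
  exists m (E : 'M[R[i]]_(m, d)) (mu : 'rV[R]_m) (K : R[i]),
  [/\ E *m E^t* = 1%:M, E^t* *m E = 1%:M, forall i, 0 <= mu 0 i, 1 <= K &
      forall n x, qform (X ^+ n + Y ^+ n) x <= K * mx_wform E mu n x /\
                  mx_wform E mu n x <= K * qform (X ^+ n + Y ^+ n) x].
Proof.
move=> Xp Yp; have [s [ss s0 sE]] := qform_expD_seq Xp Yp.
have [m [E [mu [K [EE mu_ge K0 bd]]]]] := gram_schmidt_wform ss s0.
have mu0 : forall i, 0 <= mu 0 i by apply: mu_ge.
(* Adding 1 secures the lower bound on the constant that [expr_gap] asks for. *)
exists m, E, mu, (1 + K); split=> // [||n x].
(* The rows of [E] span: for [y] orthogonal to them [mx_wform E mu 0 y] is 0, while the form of X^0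
   + Y^0 is twice the squared norm. *)
- apply/row_matrixP => i; set x := row i 1%:M.
  suff : x - x *m E^t* *m E = 0.
    move/eqP; rewrite subr_eq0 => /eqP ->.
    by rewrite -!row_mul mul1mx.
  apply/eqP; rewrite -qform1_eq0; set y := _ - _.
  have [] := bd 0%N y; rewrite -sE !expr0 qformD => le _.
  have yE : y *m E^t* = 0.
    by rewrite /y mulmxBl -[_ *m E *m _]mulmxA EE mulmx1 subrr.
  have w0 : mx_wform E mu 0 y = 0.
    by rewrite /mx_wform big1 // => j _; rewrite yE mxE normr0 expr0n mulr0.
  move: le; rewrite w0 mulr0 => le; rewrite eq_le qform1_ge0 andbT.
  by apply: le_trans le; rewrite lerDl qform1_ge0.
- by rewrite lerDl.
rewrite sE; have [le1 le2] := bd n x; split.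
  by apply: le_trans le1 _; rewrite ler_wpM2r ?lerDr // mx_wform_ge0.
by apply: le_trans le2 _; rewrite ler_wpM2r ?lerDr // seq_wform_ge0.
Qed.

(** * Existence and properties of Kato's limit *)

Lemma norm_unitary_entry (C : numClosedFieldType) m d (V : 'M[C]_(m, d)) i j :
  V *m V^t* = 1%:M -> `|V i j| <= 1.
Proof.
move=> VV; rewrite -(@ler_pXn2r _ 2) ?nnegrE // expr1n -(qform1_row i VV).
by rewrite qform1E (bigD1 j) //= mxE lerDl sumr_ge0.
Qed.

(** For unitary [E], the matrix whose n-th power has the form [mx_wform E mu n]; it turns out to be
    Kato's limit. *)
Definition asymp_mx (R : realType) m d (E : 'M[R[i]]_(m, d)) (mu : 'rV[R]_m) :=
  E^t* *m diag_mx (map_mx (fun r => r%:C%C) mu) *m E.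

(* In the bases of eigenvectors P of C and E, the (j, a) entry of the
   difference is (rho_j - mu_a) G_ja with G = P E^*, and the two-sided bound
   says that rho_j^n and mu_a^n agree up to the factor K / |G_ja|^2. *)
Lemma mxroot_asymp (R : realType) m d (E : 'M[R[i]]_(m, d)) (mu : 'rV[R]_m)
    (K : R[i]) n (C : 'M[R[i]]_d) i j :
  E *m E^t* = 1%:M -> E^t* *m E = 1%:M -> (forall i, 0 <= mu 0 i) -> 1 <= K ->
  (0 < n)%N -> psdmx C ->
  (forall x, qform C x <= K * mx_wform E mu n x /\
             mx_wform E mu n x <= K * qform C x) ->
  `|(mxroot n C - asymp_mx E mu) i j| * n./2%:R
    <= \sum_(k < d) \sum_a K * (mu 0 a)%:C%C.
Proof.
move=> EE E'E mu0 K1 n0 Cp bd.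
have [PP P'P CE lr] := hermitian_spectralE Cp.1.
rewrite /mxroot; set P := spectralmx C in PP P'P CE *.
set l := spectral_diag C in CE lr *.
pose rho := map_mx (fun z => n.-root z) l; pose G := P *m E^t*.
pose nu : 'rV[R[i]]_m := map_mx (fun r => r%:C%C) mu.
have l0 k : 0 <= l 0 k by apply: psdmx_spectral_ge0.
have rho0 k : 0 <= rho 0 k by rewrite mxE rootC_ge0.
have rhoX k : rho 0 k ^+ n = l 0 k by rewrite mxE rootCK.
have nu0 a : 0 <= nu 0 a by rewrite mxE ler0c.
have K0 : 0 <= K by rewrite (le_trans ler01).
(* Testing the two-sided bound at row [a] of [E] and at row [k] of [P], and keeping one term of each
   sum, gives the hypotheses of [expr_gap] with x = |G_ka|. *)
have gap k a : `|G k a| * `|rho 0 k - nu 0 a| * n./2%:R <= K * nu 0 a.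
  apply: expr_gap => //.
    have [le1 _] := bd (row a E).
    have -> : nu 0 a ^+ n = mx_wform E mu n (row a E).
      rewrite /mx_wform -row_mul EE (bigD1 a) //= big1 ?addr0.
        by rewrite !mxE eqxx normr1 expr1n mulr1 rmorphXn.
      by move=> b ba; rewrite !mxE eq_sym (negPf ba) normr0 expr0n mulr0.
    apply: le_trans le1.
    rewrite [X in qform X _]CE qform_diag (bigD1 k) //= rhoX.
    have -> : (row a E *m P^t*) 0 k = (G k a)^*.
      by rewrite -row_mul -[E](@trmxCK R[i]) -adjmxM !mxE.
    rewrite norm_conjC mulrC lerDl sumr_ge0 // => b _.
    by rewrite mulr_ge0 ?exprn_ge0.
  have [_ le2] := bd (row k P).
  rewrite rhoX -(qform_spectral k Cp.1); apply: le_trans le2.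
  rewrite /mx_wform (bigD1 a) //= -row_mul [row _ _ 0 a]mxE -/G.
  rewrite [nu 0 a]mxE rmorphXn mulrC lerDl sumr_ge0 // => b _.
  by rewrite mulr_ge0 ?exprn_ge0 // ler0c exprn_ge0.
(* Unitarity of [P] and [E] factors the difference; their entries, of modulus at most 1, then drop
   out of the estimate. *)
have -> : P^t* *m diag_mx rho *m P - asymp_mx E mu =
    P^t* *m (diag_mx rho *m G - G *m diag_mx nu) *m E.
  rewrite mulmxBr mulmxBl /G !mulmxA P'P mul1mx /asymp_mx -/nu; congr (_ - _).
  by rewrite -[_ *m E^t* *m E]mulmxA E'E mulmx1.
rewrite -mulmxA mxE.
apply: le_trans (ler_wpM2r _ (ler_norm_sum _ _ _)) _ => //.
rewrite mulr_suml; apply: ler_sum => k _; rewrite [(_ *m E) k j]mxE normrM.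
have Pki : `|(P^t*) i k| <= 1.
  by rewrite !mxE norm_conjC norm_unitary_entry.
rewrite -mulrA; apply: le_trans (ler_wpM2r _ Pki) _; first by rewrite mulr_ge0.
rewrite mul1r; apply: le_trans (ler_wpM2r _ (ler_norm_sum _ _ _)) _ => //.
rewrite mulr_suml; apply: ler_sum => a _; rewrite normrM.
rewrite mulrAC.
apply: le_trans (ler_wpM2l _ (norm_unitary_entry a j EE)) _.
  by rewrite mulr_ge0.
have -> H : (diag_mx rho *m H - H *m diag_mx nu) k a =
    H k a * (rho 0 k - nu 0 a).
  by rewrite mul_mx_diag mul_diag_mx !mxE; ring.
by rewrite mulr1 normrM; have := gap k a; rewrite [X in _ <= _ * X]mxE.
Qed.

(** The sign conditions make [b] and [e] real, so the Archimedean property of [R] applies. *)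
Lemma complex_archimedean (R : realType) (b e : R[i]) :
  0 <= b -> 0 < e -> exists N : nat, forall n, (N <= n)%N -> b < e * n%:R.
Proof.
move=> b0 e0; have bE := RRe_real (ger0_real b0).
have eE := RRe_real (gtr0_real e0).
have re0 : 0 < complex.Re e by rewrite -ltcR eE.
exists (Num.bound (complex.Re b / complex.Re e)) => n Nn.
rewrite -bE -eE -[n%:R](rmorph_nat (real_complex R)) -rmorphM /= ltcR mulrC.
rewrite -ltr_pdivrMr //; apply: lt_le_trans (archi_boundP _) _.
  by rewrite divr_ge0 ?(ltW re0) // -ler0c bE.
by rewrite ler_nat.
Qed.

(* Stated for an abstract C because the topology used by maxmod is the one
   that any numClosedFieldType carries. *)
Lemma lim_mx_rate (C : numClosedFieldType) m d (f : nat -> 'M[C]_(m, d))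
    (M : 'M[C]_(m, d)) (B : C) :
  (forall e : C, 0 < e -> exists N, forall n, (N <= n)%N -> B < e * n%:R) ->
  (forall n i j, (0 < n)%N -> `|(f n - M) i j| * n./2%:R <= B) ->
  lim (f @ \oo)%classic = M.
Proof.
move=> archB fB; apply: cvg_lim; first exact: norm_hausdorff.
apply/cvg_ballP => e e0; have [N BN] := archB _ e0.
(* Doubling compensates for the half in the rate: n >= 2 (N + 1) gives n./2 > N. *)
exists N.+1.*2 => // n /= Nn; split=> // i j.
have n0 : (0 < n)%N by apply: leq_trans Nn.
have hN : (N < n./2)%N by rewrite -(doubleK N.+1) half_leq.
rewrite /ball /= distrC.
have := le_lt_trans (fB n i j n0) (BN _ (ltnW hN)).
by rewrite !mxE ltr_pM2r // ltr0n (leq_ltn_trans _ hN).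
Qed.

Lemma qform_entries_le (C : numClosedFieldType) d (D : 'M[C]_d) (B : C) x :
  (forall i j, `|D i j| <= B) ->
  `|qform D x| <= B * (\sum_i `|x 0 i|) ^+ 2.
Proof.
move=> DB; rewrite /qform mxE; apply: le_trans (ler_norm_sum _ _ _) _.
rewrite expr2 mulrA mulr_sumr; apply: ler_sum => j _.
have -> : (x^t*) j 0 = (x 0 j)^* by rewrite !mxE.
rewrite normrM norm_conjC ler_wpM2r //.
rewrite [(x *m D) 0 j]mxE; apply: le_trans (ler_norm_sum _ _ _) _.
by rewrite mulr_sumr; apply: ler_sum => i _; rewrite normrM mulrC ler_wpM2r.
Qed.

Lemma maxmod_spec (R : realType) d (A : 'M[R[i]]_d) :
  [/\ psdmx (maxmod A), forall x, qform (mxabs A) x <= qform (maxmod A) x &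
      forall x, qform (mxabs (A^t*)) x <= qform (maxmod A) x].
Proof.
set X := mxabs A; set Y := mxabs (A^t*).
have [Xp Yp] : psdmx X /\ psdmx Y by split; apply: psdmx_mxabs.
have [m [E [mu [K [EE E'E mu0 K1 bd]]]]] := qform_expD_asymp Xp Yp.
pose S n := X ^+ n + Y ^+ n.
have Sp n : psdmx (S n) by apply: psdmxD; apply: psdmxX.
pose B := \sum_(k < d) \sum_a K * (mu 0 a)%:C%C.
have B0 : 0 <= B.
  rewrite sumr_ge0 // => k _; rewrite sumr_ge0 // => a _.
  by rewrite mulr_ge0 ?ler0c // (le_trans ler01).
set M := asymp_mx E mu.
have rate n i j : (0 < n)%N -> `|(mxroot n (S n) - M) i j| * n./2%:R <= B.
  by move=> n0; exact: (mxroot_asymp i j EE E'E mu0 K1 n0 (Sp n) (bd n)).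
have -> : maxmod A = M.
  by apply: (lim_mx_rate _ rate) => e e0; apply: complex_archimedean.
have Mp : psdmx M by apply: psdmx_diag => i; rewrite mxE ler0c.
have leM Z : psdmx Z -> (forall n x, qform (Z ^+ n) x <= qform (S n) x) ->
    forall x, qform Z x <= qform M x.
  move=> Zp leS x.
  (* The two values are real, hence comparable. A strict reverse inequality is refuted at n =
     2^(N+1), with N so large that the error B W / 2^N is below the gap. *)
  have [|lt] := real_leP (ger0_real (Zp.2 x)) (ger0_real (Mp.2 x)) => //.
  pose W := (\sum_i `|x 0 i|) ^+ 2.
  have W0 : 0 <= B * W.
    by rewrite mulr_ge0 // exprn_ge0 // sumr_ge0.
  have d0 : 0 < qform Z x - qform M x by rewrite subr_gt0.
  have [N BN] := complex_archimedean W0 d0.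
  have n0 : (0 < 2 ^ N.+1)%N by rewrite expn_gt0.
  set n := (2 ^ N.+1)%N in n0.
  have hn : n./2 = (2 ^ N)%N by rewrite /n expnS mul2n doubleK.
  have hn0 : 0 < n./2%:R :> R[i] by rewrite hn ltr0n expn_gt0.
  (* Iterated square roots carry the inequality between [Z ^+ n] and [S n] down to [Z]. *)
  have le1 : qform Z x <= qform (mxroot n (S n)) x.
    have Rp := psdmx_mxroot n0 (Sp n).
    have RX := mxrootK n0 (Sp n).
    move: (mxroot n (S n)) Rp RX => Rn Rp RX.
    apply: (psdmx_root2X_mono (k := N.+1) Zp Rp) => y.
    by rewrite -/n RX; apply: leS.
  have : `|qform (mxroot n (S n) - M) x| <= (B / n./2%:R) * W.
    by apply: qform_entries_le => i j; rewrite ler_pdivlMr // rate.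
  rewrite qformB ger0_norm; last by rewrite subr_ge0 (le_trans (ltW lt)).
  move=> le2; have le3 : qform Z x - qform M x <= B / n./2%:R * W.
    by apply: le_trans le2; rewrite lerD2r.
  have := BN n./2; rewrite -ltr_pdivrMr // mulrAC => /(_ _) BN'.
  have := le_lt_trans le3 (BN' _); rewrite ltxx => -> //.
  by rewrite hn ltnW // ltn_expl.
split; [exact: Mp | apply: (leM X Xp) | apply: (leM Y Yp)] => n x.
  rewrite /S qformD.
  by rewrite lerDl; case: (psdmxX n Yp).
by rewrite /S qformD lerDr; case: (psdmxX n Xp).
Qed.

Theorem corollary3p6 (R : realType) (d m : nat) (hd : (1 <= d)%N) (hm : (1 <= m)%N)
  (A : 'I_m -> 'M[R[i]]_d) :
  wlog_majorized (mxabs (\sum_(k < m) A k)) (\sum_(k < m) maxmod (A k)).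
Proof.
apply: dominates_wlog.
  by apply: psdmx_sum => k; case: (maxmod_spec (A k)).
apply: dominates_sum => k; have [_ le1 le2] := maxmod_spec (A k).
(* [dominates_mxabs] pairs |A^*| with |A|; [maxmod] lies above both, so a single matrix serves on
   both sides, as [dominates_wlog] requires. *)
exact: dominates_mono le2 le1 (dominates_mxabs _).
Qed.
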